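(* (ZF, without the Axiom of Choice.) For each cardinal $\kappa\in On$ and each $\mu\in On$ there is a cardinal $\lambda\in On$ such that $\lambda\to(\kappa)^2_\mu$.
   Context: The base theory is ZF. Cardinals are initial ordinals. $\lambda\to(\kappa)^2_\mu$ means: for every function $c:[\lambda]^2\to\mu$ there is a set $H\subset\lambda$ of cardinality $\kappa$ such that $c$ is constant on $[H]^2$. *)

(* Defs.v *)
(* "ZF proves phi" is rendered as "phi holds in every model of ZF".
   ZF is the first-order theory: Separation and Replacement range over
   (deeply embedded) formulas with parameters, not over arbitrary Rocq
   predicates.  Quantifying over Rocq predicates would give second-order ZF,
   in whose models choice principles of the ambient logic yield AC. *)

Record set_structure := {
  carrier :> Type;
  mem : carrier -> carrier -> Prop
}.

Arguments mem {_} _ _.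

Declare Scope zf_scope.
Delimit Scope zf_scope with zf.
Notation "x ∈ y" := (mem x y) (at level 70, no associativity) : zf_scope.
Local Open Scope zf_scope.

(* De Bruijn indices: [fAll] and [fEx] bind index 0 and shift the others. *)
Inductive formula : Type :=
| fMem (i j : nat)
| fEq (i j : nat)
| fFalse
| fImp (p q : formula)
| fAnd (p q : formula)
| fOr (p q : formula)
| fAll (p : formula)
| fEx (p : formula).

Definition scons {X : Type} (x : X) (e : nat -> X) (n : nat) : X :=
  match n with O => x | S m => e m end.

Fixpoint sat {M : set_structure} (e : nat -> M) (p : formula) : Prop :=
  match p with
  | fMem i j => e i ∈ e j
  | fEq i j => e i = e j
  | fFalse => False
  | fImp p q => sat e p -> sat e q
  | fAnd p q => sat e p /\ sat e q
  | fOr p q => sat e p \/ sat e q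
  | fAll p => forall x : M, sat (scons x e) p
  | fEx p => exists x : M, sat (scons x e) p
  end.

Definition subset {M : set_structure} (a b : M) : Prop :=
  forall x : M, x ∈ a -> x ∈ b.

Definition is_empty {M : set_structure} (a : M) : Prop :=
  forall x : M, ~ x ∈ a.

Definition is_succ {M : set_structure} (s a : M) : Prop :=
  forall x : M, x ∈ s <-> x ∈ a \/ x = a.

Definition is_upair {M : set_structure} (p a b : M) : Prop :=
  forall x : M, x ∈ p <-> x = a \/ x = b.

Record ZF (M : set_structure) : Prop := {
  zf_extensionality : forall a b : M, (forall x : M, x ∈ a <-> x ∈ b) -> a = b;
  zf_foundation : forall a : M, (exists x : M, x ∈ a) ->
    exists x : M, x ∈ a /\ forall y : M, y ∈ x -> ~ y ∈ a;
  zf_pairing : forall a b : M, exists p : M, is_upair p a b;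
  zf_union : forall a : M, exists u : M,
    forall x : M, x ∈ u <-> exists y : M, y ∈ a /\ x ∈ y;
  zf_powerset : forall a : M, exists p : M,
    forall x : M, x ∈ p <-> subset x a;
  zf_infinity : exists w : M,
    (exists z : M, is_empty z /\ z ∈ w) /\
    (forall x : M, x ∈ w -> exists s : M, is_succ s x /\ s ∈ w);
  zf_separation : forall (p : formula) (e : nat -> M) (a : M), exists b : M,
    forall x : M, x ∈ b <-> x ∈ a /\ sat (scons x e) p;
  zf_replacement : forall (p : formula) (e : nat -> M) (a : M),
    (forall x : M, x ∈ a -> exists! y : M, sat (scons x (scons y e)) p) ->
    exists b : M, forall y : M,
      y ∈ b <-> exists x : M, x ∈ a /\ sat (scons x (scons y e)) p
}.

(* Kuratowski pairs: p = {{x}, {x, y}}. *)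
Definition is_opair {M : set_structure} (p x y : M) : Prop :=
  exists s d : M, is_upair s x x /\ is_upair d x y /\ is_upair p s d.

Definition maps {M : set_structure} (f x y : M) : Prop :=
  exists p : M, is_opair p x y /\ p ∈ f.

(* The function f is an element of the model; its domain and codomain are
   given by their membership predicates. *)
Definition is_function {M : set_structure} (f : M) (A B : M -> Prop) : Prop :=
  (forall p : M, p ∈ f -> exists x y : M, A x /\ B y /\ is_opair p x y) /\
  (forall x : M, A x -> exists! y : M, maps f x y).

Definition elements {M : set_structure} (a : M) : M -> Prop :=
  fun x => x ∈ a.

Definition is_bijection {M : set_structure} (f a b : M) : Prop :=
  is_function f (elements a) (elements b) /\
  (forall y : M, y ∈ b -> exists! x : M, maps f x y).

Definition equinumerous {M : set_structure} (a b : M) : Prop :=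
  exists f : M, is_bijection f a b.

Definition transitive_set {M : set_structure} (a : M) : Prop :=
  forall x : M, x ∈ a -> subset x a.

Definition well_ordered_by_mem {M : set_structure} (a : M) : Prop :=
  (forall x : M, x ∈ a -> ~ x ∈ x) /\
  (forall x y z : M, x ∈ a -> y ∈ a -> z ∈ a -> x ∈ y -> y ∈ z -> x ∈ z) /\
  (forall x y : M, x ∈ a -> y ∈ a -> x ∈ y \/ x = y \/ y ∈ x) /\
  (forall b : M, subset b a -> (exists x : M, x ∈ b) ->
    exists m : M, m ∈ b /\ forall x : M, x ∈ b -> m = x \/ m ∈ x).

Definition ordinal {M : set_structure} (a : M) : Prop :=
  transitive_set a /\ well_ordered_by_mem a.

Definition cardinal {M : set_structure} (k : M) : Prop :=
  ordinal k /\ forall a : M, a ∈ k -> ~ equinumerous a k.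

(* [pairs a] is the membership predicate of [a]^2, the two-element subsets. *)
Definition pairs {M : set_structure} (a : M) : M -> Prop :=
  fun p => exists x y : M, x ∈ a /\ y ∈ a /\ x <> y /\ is_upair p x y.

Definition constant_on {M : set_structure} (c : M) (A : M -> Prop) : Prop :=
  forall p q u v : M, A p -> A q -> maps c p u -> maps c q v -> u = v.

Definition arrow2 {M : set_structure} (lam kappa mu : M) : Prop :=
  forall c : M, is_function c (pairs lam) (elements mu) ->
    exists H : M, subset H lam /\ equinumerous H kappa /\
      constant_on c (pairs H).

(* Main.v *)
(* Fix a colouring [c] of the pairs of a cardinal [lam] and order [lam] as a
   tree: [x] precedes [y] if [x] is in [y] and [c {z, x} = c {z, y}] for every
   [z] preceding [x].  A node is determined by the ranks of its predecessors
   together with their colours against it.  Hence, if all ranks were below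
   [theta], then [lam] would embed into the power set of [theta * mu], which
   is impossible when [lam] is the Hartogs number of that set.  So some node
   has rank at least [theta], and on its predecessors the colour of a pair
   depends on the smaller element only.  If [theta] is the Hartogs number of
   [mu * kappa], then some class of predecessors with the same colour has
   length at least [kappa].  Neither Hartogs number depends on [c], and no
   choice is needed.

   Since Separation and Replacement are schemas over formulas, every class
   and class function in the argument has to be definable with parameters;
   the tactic [definability] produces the formulas. *)

Require Import Defs.
From Stdlib Require Import Arith ClassicalEpsilon FunctionalExtensionality.
Local Open Scope zf_scope.

(** * Renaming the variables of a formula *)

Fixpoint rename (r : nat -> nat) (p : formula) : formula :=
  match p with
  | fMem i j => fMem (r i) (r j)
  | fEq i j => fEq (r i) (r j)
  | fFalse => fFalse
  | fImp p q => fImp (rename r p) (rename r q)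
  | fAnd p q => fAnd (rename r p) (rename r q)
  | fOr p q => fOr (rename r p) (rename r q)
  | fAll p => fAll (rename (fun n => match n with 0 => 0 | S m => S (r m) end) p)
  | fEx p => fEx (rename (fun n => match n with 0 => 0 | S m => S (r m) end) p)
  end.

(** * Definability with parameters *)

Section Definability.

Variable M : set_structure.

Lemma scons_rename (x : M) (e : nat -> M) (r : nat -> nat) :
  (fun n => scons x e (match n with 0 => 0 | S m => S (r m) end)) =
  scons x (fun n => e (r n)).
Proof. apply functional_extensionality; intros [|n]; reflexivity. Qed.

Lemma sat_rename (p : formula) : forall (r : nat -> nat) (e : nat -> M),
  sat e (rename r p) <-> sat (fun n => e (r n)) p.
Proof.
  induction p; intros r e; simpl; try tauto.
  - rewrite IHp1, IHp2; tauto.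
  - rewrite IHp1, IHp2; tauto.
  - rewrite IHp1, IHp2; tauto.
  - split; intros H x; specialize (H x); rewrite IHp, scons_rename in *;
      assumption.
  - split; intros [x H]; exists x; rewrite IHp, scons_rename in *; assumption.
Qed.

(* Index [n] of the formula denotes the variable [i] if [v n = inl i] and the
   parameter [a] if [v n = inr a]. *)
Definition valuation (v : nat -> nat + M) (e : nat -> M) (n : nat) : M :=
  match v n with inl i => e i | inr a => a end.

Definition definable (P : (nat -> M) -> Prop) : Prop :=
  exists p v, forall e, sat (valuation v e) p <-> P e.

(** The language has no function symbols, so a function is handled through its graph, with index 0
    for the value. *)
Definition term (t : (nat -> M) -> M) : Prop :=
  definable (fun e => e 0 = t (fun n => e (S n))).

Lemma definable_ext (P Q : (nat -> M) -> Prop) :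
  (forall e, P e <-> Q e) -> definable P -> definable Q.
Proof. intros H (p & v & Hp); exists p, v; intros e; rewrite Hp; apply H. Qed.

Lemma definable_rename (r : nat -> nat) (P : (nat -> M) -> Prop) :
  definable P -> definable (fun e => P (fun n => e (r n))).
Proof.
  intros (p & v & Hp).
  exists p, (fun n => match v n with inl i => inl (r i) | inr a => inr a end).
  intros e; rewrite <- Hp.
  replace (valuation _ e) with (valuation v (fun n => e (r n))); [tauto|].
  apply functional_extensionality; intros n; unfold valuation.
  now destruct (v n).
Qed.

(** A connective needs one valuation for both formulas. The two valuations are interleaved, [p]
    moving to the even indices and [q] to the odd ones. *)
Lemma definable_pair (P Q : (nat -> M) -> Prop) : definable P -> definable Q ->
  exists p q v, forall e, (sat (valuation v e) p <-> P e) /\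
    (sat (valuation v e) q <-> Q e).
Proof.
  intros (p & v & Hp) (q & w & Hq).
  exists (rename (fun n => 2 * n) p), (rename (fun n => S (2 * n)) q),
    (fun n => if Nat.even n then v (Nat.div2 n) else w (Nat.div2 n)).
  intros e; rewrite !sat_rename, <- Hp, <- Hq.
  replace (fun n => valuation _ e (2 * n)) with (valuation v e).
  replace (fun n => valuation _ e (S (2 * n))) with (valuation w e).
  { tauto. }
  all: apply functional_extensionality; intros n; unfold valuation.
  - now rewrite Nat.even_succ, Nat.odd_even, Nat.div2_succ_double.
  - now rewrite Nat.even_even, Nat.div2_double.
Qed.

Lemma definable_and (P Q : (nat -> M) -> Prop) :
  definable P -> definable Q -> definable (fun e => P e /\ Q e).
Proof.
  intros HP HQ; destruct (definable_pair P Q HP HQ) as (p & q & v & H).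
  exists (fAnd p q), v; intros e; simpl; destruct (H e); tauto.
Qed.

Lemma definable_or (P Q : (nat -> M) -> Prop) :
  definable P -> definable Q -> definable (fun e => P e \/ Q e).
Proof.
  intros HP HQ; destruct (definable_pair P Q HP HQ) as (p & q & v & H).
  exists (fOr p q), v; intros e; simpl; destruct (H e); tauto.
Qed.

Lemma definable_imp (P Q : (nat -> M) -> Prop) :
  definable P -> definable Q -> definable (fun e => P e -> Q e).
Proof.
  intros HP HQ; destruct (definable_pair P Q HP HQ) as (p & q & v & H).
  exists (fImp p q), v; intros e; simpl; destruct (H e); tauto.
Qed.

Lemma definable_iff (P Q : (nat -> M) -> Prop) :
  definable P -> definable Q -> definable (fun e => P e <-> Q e).
Proof. intros HP HQ; apply definable_and; apply definable_imp; assumption. Qed.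

Lemma definable_False : definable (fun _ => False).
Proof. exists fFalse, (fun n => inl n); simpl; tauto. Qed.

Lemma definable_not (P : (nat -> M) -> Prop) :
  definable P -> definable (fun e => ~ P e).
Proof. intros HP; apply definable_imp; [exact HP | apply definable_False]. Qed.

(** Several indices may denote the variable about to be bound. All of them are merged into index 0
    and every other index is shifted up. Where [v n] is [inl 0], the new valuation has a dummy
    value, since index [S n] no longer occurs. *)
Lemma definable_bind (P : M -> (nat -> M) -> Prop) :
  definable (fun e => P (e 0) (fun n => e (S n))) ->
  exists p w, forall e x, sat (scons x (valuation w e)) p <-> P x e.
Proof.
  intros (p & v & Hp).
  exists (rename (fun n => match v n with inl 0 => 0 | _ => S n end) p),
    (fun n => match v n with
              | inl 0 => inl 0 | inl (S i) => inl i | inr a => inr a end).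
  intros e x; rewrite sat_rename.
  change (P x e) with
    ((fun e' => P (e' 0) (fun n => e' (S n))) (scons x e)).
  rewrite <- Hp.
  replace (fun n => scons _ _ _) with (valuation v (scons x e)); [tauto|].
  apply functional_extensionality; intros n; unfold valuation.
  destruct (v n) as [[|i]|a] eqn:Hv; simpl; try rewrite Hv; reflexivity.
Qed.

Lemma definable_all (P : M -> (nat -> M) -> Prop) :
  definable (fun e => P (e 0) (fun n => e (S n))) ->
  definable (fun e => forall x, P x e).
Proof.
  intros (p & w & H)%definable_bind.
  exists (fAll p), w; intros e; simpl; split; intros K x; apply H, K.
Qed.

Lemma definable_ex (P : M -> (nat -> M) -> Prop) :
  definable (fun e => P (e 0) (fun n => e (S n))) ->
  definable (fun e => exists x, P x e).
Proof.
  intros (p & w & H)%definable_bind.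
  exists (fEx p), w; intros e; simpl; split; intros [x K]; exists x; apply H, K.
Qed.

Lemma term_var (i : nat) : term (fun e => e i).
Proof.
  exists (fEq 0 (S i)), (fun n => inl n); reflexivity.
Qed.

Lemma term_const (a : M) : term (fun _ => a).
Proof.
  exists (fEq 0 1), (fun n => match n with 0 => inl 0 | _ => inr a end).
  reflexivity.
Qed.

Lemma term_rename (r : nat -> nat) (t : (nat -> M) -> M) :
  term t -> term (fun e => t (fun n => e (r n))).
Proof.
  intros H.
  exact (definable_rename (fun n => match n with 0 => 0 | S m => S (r m) end) _ H).
Qed.

(** Substitution is expressed by a quantifier: some [x] equals [t e] and satisfies [P]. *)
Lemma definable_subst (P : M -> (nat -> M) -> Prop) (t : (nat -> M) -> M) :
  term t -> definable (fun e => P (e 0) (fun n => e (S n))) ->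
  definable (fun e => P (t e) e).
Proof.
  intros Ht HP.
  apply definable_ext with (fun e => exists x, x = t e /\ P x e).
  - intros e; split; [intros (x & -> & H); exact H | eauto].
  - apply definable_ex, definable_and; assumption.
Qed.

Definition definable1 (P : M -> Prop) : Prop := definable (fun e => P (e 0)).
Definition definable2 (R : M -> M -> Prop) : Prop :=
  definable (fun e => R (e 0) (e 1)).
Definition function1 (F : M -> M) : Prop := term (fun e => F (e 0)).
Definition function2 (F : M -> M -> M) : Prop := term (fun e => F (e 0) (e 1)).

Lemma definable1_subst (P : M -> Prop) (s : (nat -> M) -> M) :
  definable1 P -> term s -> definable (fun e => P (s e)).
Proof.
  intros HP Hs.
  apply (definable_subst (fun x _ => P x)); assumption.
Qed.

Lemma definable2_subst (R : M -> M -> Prop) (s t : (nat -> M) -> M) :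
  definable2 R -> term s -> term t -> definable (fun e => R (s e) (t e)).
Proof.
  intros HR Hs Ht.
  apply (definable_subst (fun x e => R x (t e))); [exact Hs|].
  apply (definable_subst (fun y e => R (e 0) y)); [now apply (term_rename S)|].
  (* The argument substituted last sits at index 0, so the two indices are in reverse order. *)
  exact (definable_rename (fun n => match n with 0 => 1 | _ => 0 end) _ HR).
Qed.

Lemma definable_mem (s t : (nat -> M) -> M) :
  term s -> term t -> definable (fun e => s e ∈ t e).
Proof.
  apply (definable2_subst (fun x y => x ∈ y)).
  now exists (fMem 0 1), (fun n => inl n).
Qed.

Lemma definable_eq (s t : (nat -> M) -> M) :
  term s -> term t -> definable (fun e => s e = t e).
Proof.
  apply (definable2_subst (fun x y => x = y)).
  now exists (fEq 0 1), (fun n => inl n).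
Qed.

Lemma term_subst (F : M -> (nat -> M) -> M) (t : (nat -> M) -> M) :
  term t -> term (fun e => F (e 0) (fun n => e (S n))) ->
  term (fun e => F (t e) e).
Proof.
  intros Ht HF.
  apply (definable_subst (fun x e => e 0 = F x (fun n => e (S n)))).
  - now apply (term_rename S).
  - exact (definable_rename
      (fun n => match n with 0 => 1 | 1 => 0 | n => n end) _ HF).
Qed.

Lemma function1_subst (F : M -> M) (s : (nat -> M) -> M) :
  function1 F -> term s -> term (fun e => F (s e)).
Proof. intros HF Hs; apply (term_subst (fun x _ => F x)); assumption. Qed.

Lemma function2_subst (F : M -> M -> M) (s t : (nat -> M) -> M) :
  function2 F -> term s -> term t -> term (fun e => F (s e) (t e)).
Proof.
  intros HF Hs Ht.
  apply (term_subst (fun x e => F x (t e))); [exact Hs|].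
  apply (term_subst (fun y e => F (e 0) y)); [now apply (term_rename S)|].
  exact (definable_rename
    (fun n => match n with 0 => 0 | 1 => 2 | 2 => 1 | n => n end) _ HF).
Qed.

End Definability.

Arguments definable {M} P.
Arguments term {M} t.
Arguments definable1 {M} P.
Arguments definable2 {M} R.
Arguments function1 {M} F.
Arguments function2 {M} F.
Arguments definable_subst {M} P t.
Arguments term_subst {M} F t.

(* Extended by [::=] once further term constructors are available. *)
Ltac definable_constant := fail.

Ltac definability :=
  cbv beta;
  lazymatch goal with
  | |- definable1 _ => unfold definable1; definability
  | |- definable2 _ => unfold definable2; definability
  | |- function1 _ => unfold function1; definability
  | |- function2 _ => unfold function2; definability
  | |- definable (fun e => _ /\ _) => apply definable_and; definability
  | |- definable (fun e => _ \/ _) => apply definable_or; definability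
  | |- definable (fun e => _ <-> _) => apply definable_iff; definability
  | |- definable (fun e => ~ _) => apply definable_not; definability
  | |- definable (fun e => False) => apply definable_False
  | |- definable (fun e => exists x, _) => apply definable_ex; definability
  | |- definable (fun e => _ ∈ _) => apply definable_mem; definability
  | |- definable (fun e => _ = _) => apply definable_eq; definability
  (* An implication matches this pattern too, as a product over a proposition; there [definable_all]
     fails and [definable_imp] applies. *)
  | |- definable (fun e => forall x, _) =>
      first [apply definable_all | apply definable_imp]; definability
  | |- term (fun e => e _) => apply term_var
  | |- _ =>
      first
        [ assumption
        | apply term_const
        | match goal with
          | H : definable1 ?P |- definable (fun e => ?P _) =>
              apply (definable1_subst _ P _ H)
          | H : definable2 ?P |- definable (fun e => ?P _ _) =>
              apply (definable2_subst _ P _ _ H)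
          | H : function1 ?F |- term (fun e => ?F _) =>
              apply (function1_subst _ F _ H)
          | H : function2 ?F |- term (fun e => ?F _ _) =>
              apply (function2_subst _ F _ _ H)
          end; definability
        | definable_constant; definability
        | match goal with
          | H : term ?t |- term _ => exact (term_rename _ _ t H)
          end ]
  end.

(** * Sets, pairs and functions *)

Section SetTheory.

Variable M : set_structure.
Hypothesis hZF : ZF M.

Lemma set_ext (a b : M) : (forall x, x ∈ a <-> x ∈ b) -> a = b.
Proof. apply (zf_extensionality M hZF). Qed.

Lemma separation (P : M -> Prop) (a : M) : definable1 P ->
  exists b, forall x, x ∈ b <-> x ∈ a /\ P x.
Proof.
  intros HP.
  destruct (definable_bind M (fun x _ => P x) HP) as (p & w & H).
  destruct (zf_separation M hZF p (valuation M w (fun _ => a)) a) as [b Hb].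
  exists b; intros x; now rewrite Hb, H.
Qed.

(** The axiom asks for a value at every element of the set, so [a] is first cut down to the domain
    [d] of [R]. *)
Lemma replacement (R : M -> M -> Prop) (a : M) : definable2 R ->
  (forall x y z, x ∈ a -> R x y -> R x z -> y = z) ->
  exists b, forall y, y ∈ b <-> exists x, x ∈ a /\ R x y.
Proof.
  intros HR Hfun.
  destruct (separation (fun x => exists y, R x y) a) as [d Hd].
  { definability. }
  assert (HR' : definable (fun e : nat -> M => R (e 0) (e 1))) by exact HR.
  destruct HR' as (p & v & Hp).
  (* [R] reads only variables 0 and 1, so all variables from 1 on may denote [y] and share index 1.
     Parameters move past the two variables; the value [a] of [w] elsewhere is a dummy. *)
  pose (r n := match v n with
               | inl 0 => 0 | inl (S _) => 1 | inr _ => S (S n) end).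
  pose (w n := match v n with inl _ => a | inr c => c end).
  assert (Hs : forall x y, sat (scons x (scons y w)) (rename r p) <-> R x y).
  { intros x y; rewrite sat_rename.
    change (R x y) with
      ((fun e : nat -> M => R (e 0) (e 1)) (scons x (fun _ => y))).
    rewrite <- Hp.
    replace (fun n => scons _ _ _)
      with (valuation M v (scons x (fun _ => y))); [tauto|].
    apply functional_extensionality; intros n; unfold valuation, r.
    destruct (v n) as [[|i]|c] eqn:Hv; simpl; try reflexivity.
    unfold w; now rewrite Hv. }
  destruct (zf_replacement M hZF (rename r p) w d) as [b Hb].
  - intros x Hx; apply Hd in Hx as [Hx [y Hy]].
    exists y; split; [now apply Hs|].
    intros z Hz; apply Hs in Hz; eauto.
  - exists b; intros y; rewrite Hb; split.
    + intros (x & Hx & H); apply Hd in Hx; apply Hs in H; exists x; tauto.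
    + intros (x & Hx & H); exists x; rewrite Hs, Hd; eauto.
Qed.

Lemma empty_exists : exists z : M, is_empty z.
Proof. destruct (zf_infinity M hZF) as (w & (z & Hz & _) & _); eauto. Qed.

Lemma carrier_inhabited : inhabited M.
Proof. destruct empty_exists as [z _]; exact (inhabits z). Qed.

(* Definite description, with value the empty set if [P] does not determine a
   unique element; this keeps [the] definable. *)
Definition is_the (P : M -> Prop) (y : M) : Prop :=
  (P y /\ forall z, P z -> z = y) \/
  (~ (exists x, P x /\ forall z, P z -> z = x) /\ forall x, ~ x ∈ y).

Definition the (P : M -> Prop) : M := epsilon carrier_inhabited (is_the P).

Lemma the_spec (P : M -> Prop) : is_the P (the P).
Proof.
  unfold the; apply epsilon_spec.
  destruct (classic (exists x, P x /\ forall z, P z -> z = x)) as [[x Hx]|H].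
  - exists x; now left.
  - destruct empty_exists as [z Hz]; exists z; now right.
Qed.

Lemma is_the_unique (P : M -> Prop) (y z : M) : is_the P y -> is_the P z -> y = z.
Proof.
  intros [[Hy1 Hy2]|[Hy1 Hy2]] [[Hz1 Hz2]|[Hz1 Hz2]]; auto.
  - exfalso; eauto.
  - exfalso; eauto.
  - apply set_ext; intros x; split; intros H; exfalso; firstorder.
Qed.

Lemma the_eq (P : M -> Prop) (x : M) :
  P x -> (forall z, P z -> z = x) -> the P = x.
Proof.
  intros H1 H2; apply (is_the_unique P); [apply the_spec | now left].
Qed.

Lemma the_holds (P : M -> Prop) (x : M) :
  P x -> (forall z, P z -> z = x) -> P (the P).
Proof. intros H1 H2; now rewrite (the_eq P x H1 H2). Qed.

Lemma term_the (P : M -> (nat -> M) -> Prop) :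
  definable (fun e => P (e 0) (fun n => e (S n))) ->
  term (fun e => the (fun x => P x e)).
Proof.
  intros HP.
  apply definable_ext with
    (fun e => is_the (fun x => P x (fun n => e (S n))) (e 0)).
  - intros e; split.
    + intros H; exact (is_the_unique _ _ _ H (the_spec _)).
    + intros ->; apply the_spec.
  (* [P] occurs in [is_the] under zero, one and two quantifiers; each depth needs its own shift of
     the hypothesis. *)
  - assert (H1 : definable (fun e => P (e 0) (fun n => e (S n)))) by exact HP.
    assert (H2 : definable (fun e => P (e 0) (fun n => e (S (S n))))).
    { exact (definable_rename M
        (fun n => match n with 0 => 0 | S m => S (S m) end) _ HP). }
    assert (H3 : definable (fun e => P (e 0) (fun n => e (S (S (S n)))))).
    { exact (definable_rename M
        (fun n => match n with 0 => 0 | S m => S (S (S m)) end) _ HP). }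
    unfold is_the; definability.
Qed.

(** A total operation: if no such set exists, as may happen for an undefinable [P], the value is the
    empty set. *)
Definition sep (a : M) (P : M -> Prop) : M :=
  the (fun b => forall x, x ∈ b <-> x ∈ a /\ P x).

Lemma sep_spec (a : M) (P : M -> Prop) : definable1 P ->
  forall x, x ∈ sep a P <-> x ∈ a /\ P x.
Proof.
  intros [b Hb]%(separation P a).
  apply (the_holds (fun b => forall x, x ∈ b <-> x ∈ a /\ P x) b); [exact Hb|].
  intros z Hz; apply set_ext; intros x; now rewrite Hb, Hz.
Qed.

Lemma term_sep (t : (nat -> M) -> M) (P : M -> (nat -> M) -> Prop) :
  term t -> definable (fun e => P (e 0) (fun n => e (S n))) ->
  term (fun e => sep (t e) (fun x => P x e)).
Proof.
  intros Ht HP.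
  assert (H2 : definable (fun e => P (e 0) (fun n => e (S (S n))))).
  { exact (definable_rename M
      (fun n => match n with 0 => 0 | S m => S (S m) end) _ HP). }
  apply term_the; definability.
Qed.

Definition image (a : M) (F : M -> M) : M :=
  the (fun b => forall y, y ∈ b <-> exists x, x ∈ a /\ y = F x).

Lemma image_spec (a : M) (F : M -> M) : function1 F ->
  forall y, y ∈ image a F <-> exists x, x ∈ a /\ y = F x.
Proof.
  intros HF.
  destruct (replacement (fun x y => y = F x) a) as [b Hb].
  - definability.
  - congruence.
  - apply (the_holds
      (fun b => forall y, y ∈ b <-> exists x, x ∈ a /\ y = F x) b Hb).
    intros z Hz; apply set_ext; intros x; now rewrite Hb, Hz.
Qed.

Lemma term_image (t : (nat -> M) -> M) (F : M -> (nat -> M) -> M) :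
  term t -> term (fun e => F (e 0) (fun n => e (S n))) ->
  term (fun e => image (t e) (fun x => F x e)).
Proof.
  intros Ht HF.
  assert (H2 : term (fun e => F (e 0) (fun n => e (S (S (S n)))))).
  { exact (term_rename M
      (fun n => match n with 0 => 0 | S m => S (S (S m)) end) _ HF). }
  apply term_the; definability.
Qed.

Definition power (a : M) : M := the (fun p => forall x, x ∈ p <-> subset x a).

Lemma power_spec (a x : M) : x ∈ power a <-> subset x a.
Proof.
  destruct (zf_powerset M hZF a) as [p Hp].
  revert x; apply (the_holds (fun p => forall x, x ∈ p <-> subset x a) p Hp).
  intros z Hz; apply set_ext; intros x; now rewrite Hp, Hz.
Qed.

Definition union (a : M) : M :=
  the (fun u => forall x, x ∈ u <-> exists y, y ∈ a /\ x ∈ y).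

Lemma union_spec (a x : M) : x ∈ union a <-> exists y, y ∈ a /\ x ∈ y.
Proof.
  destruct (zf_union M hZF a) as [u Hu]; revert x.
  apply (the_holds
    (fun u => forall x, x ∈ u <-> exists y, y ∈ a /\ x ∈ y) u Hu).
  intros z Hz; apply set_ext; intros x; now rewrite Hu, Hz.
Qed.

Definition upair (a b : M) : M := the (fun p => is_upair p a b).

Lemma upair_iff (p a b : M) : is_upair p a b <-> p = upair a b.
Proof.
  destruct (zf_pairing M hZF a b) as [q Hq].
  assert (Hu : forall z, is_upair z a b -> z = q).
  { intros z Hz; apply set_ext; intros x; now rewrite (Hq x), (Hz x). }
  unfold upair; rewrite (the_eq _ q Hq Hu).
  split; [apply Hu | now intros ->].
Qed.

Lemma upair_spec (a b x : M) : x ∈ upair a b <-> x = a \/ x = b.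
Proof. now apply (proj2 (upair_iff (upair a b) a b)). Qed.

Lemma upair_sym (a b : M) : upair a b = upair b a.
Proof. apply set_ext; intros x; rewrite !upair_spec; tauto. Qed.

Lemma term_upair (s t : (nat -> M) -> M) :
  term s -> term t -> term (fun e => upair (s e) (t e)).
Proof. intros Hs Ht; apply term_the; unfold is_upair; definability. Qed.

Definition opair (a b : M) : M := upair (upair a a) (upair a b).

Lemma opair_iff (p a b : M) : is_opair p a b <-> p = opair a b.
Proof.
  unfold is_opair, opair; split.
  - intros (s & d & Hs & Hd & Hp); apply upair_iff in Hs, Hd, Hp; congruence.
  - intros ->; exists (upair a a), (upair a b); now rewrite !upair_iff.
Qed.

Lemma opair_inj (a b a' b' : M) :
  opair a b = opair a' b' -> a = a' /\ b = b'.
Proof.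
  intros H.
  assert (Ha : a = a').
  { assert (K : upair a' a' ∈ opair a b)
      by (rewrite H; apply upair_spec; now left).
    assert (L : a ∈ upair a' a').
    { apply upair_spec in K as [-> | ->]; apply upair_spec; now left. }
    apply upair_spec in L; tauto. }
  subst a'; split; [reflexivity|].
  assert (K : upair a b ∈ opair a b') by (rewrite <- H; apply upair_spec; now right).
  assert (K' : upair a b' ∈ opair a b) by (rewrite H; apply upair_spec; now right).
  assert (Hb : b ∈ upair a b) by (apply upair_spec; now right).
  assert (Hb' : b' ∈ upair a b') by (apply upair_spec; now right).
  apply upair_spec in K, K'.
  destruct K as [K|K], K' as [K'|K']; rewrite K in Hb; rewrite K' in Hb';
    apply upair_spec in Hb, Hb'; intuition congruence.
Qed.

Lemma term_opair (s t : (nat -> M) -> M) :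
  term s -> term t -> term (fun e => opair (s e) (t e)).
Proof. intros Hs Ht; apply term_upair; apply term_upair; assumption. Qed.

Definition app (f x : M) : M := the (fun y => opair x y ∈ f).

Lemma term_app (s t : (nat -> M) -> M) :
  term s -> term t -> term (fun e => app (s e) (t e)).
Proof.
  intros Hs Ht; apply term_the; apply definable_mem; [|definability].
  apply term_opair; definability.
Qed.

(** Turns the restriction of a class function into a set of the model, over which formulas can
    quantify. *)
Definition graph (F : M -> M) (a : M) : M := image a (fun x => opair x (F x)).

Lemma graph_spec (F : M -> M) (a : M) : function1 F ->
  forall x y, opair x y ∈ graph F a <-> x ∈ a /\ y = F x.
Proof.
  intros HF x y; unfold graph.
  rewrite image_spec by (apply term_opair; definability).
  split.
  - intros (x' & Hx & H); apply opair_inj in H as [-> ->]; tauto.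
  - intros [Hx ->]; eauto.
Qed.

Lemma app_graph (F : M -> M) (a x : M) :
  function1 F -> x ∈ a -> app (graph F a) x = F x.
Proof.
  intros HF Hx; apply the_eq.
  - now apply graph_spec.
  - intros z Hz; now apply graph_spec in Hz.
Qed.

Lemma graph_ext (F G : M -> M) (a : M) : function1 F -> function1 G ->
  (forall x, x ∈ a -> F x = G x) -> graph F a = graph G a.
Proof.
  intros HF HG H; apply set_ext; intros p; unfold graph.
  rewrite !image_spec by (apply term_opair; definability).
  split; intros (x & Hx & ->); exists x; split; auto; now rewrite H.
Qed.

Lemma term_graph (F : M -> (nat -> M) -> M) (t : (nat -> M) -> M) :
  term (fun e => F (e 0) (fun n => e (S n))) -> term t ->
  term (fun e => graph (fun x => F x e) (t e)).
Proof.
  intros HF Ht; apply (term_image _ (fun x e => opair x (F x e))); [exact Ht|].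
  apply term_opair; [definability | exact HF].
Qed.

Definition prod (a b : M) : M :=
  union (image a (fun x => image b (fun y => opair x y))).

Lemma prod_spec (a b x y : M) : x ∈ a -> y ∈ b -> opair x y ∈ prod a b.
Proof.
  assert (H1 : forall x, function1 (fun y => opair x y))
    by (intros z; apply term_opair; definability).
  assert (H2 : function1 (fun x => image b (fun y => opair x y))).
  { apply (term_image (fun _ => b) (fun y e => opair (e 0) y)); [definability|].
    apply term_opair; definability. }
  intros Hx Hy; apply union_spec.
  exists (image b (fun y => opair x y)).
  split; apply image_spec; eauto.
Qed.

Lemma maps_iff (f x y : M) : maps f x y <-> opair x y ∈ f.
Proof.
  unfold maps; split.
  - intros (p & Hp & H); apply opair_iff in Hp; now subst p.
  - intros H; exists (opair x y); now rewrite opair_iff.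
Qed.

Lemma maps_app (f : M) (A B : M -> Prop) (x y : M) : is_function f A B -> A x ->
  (maps f x y <-> y = app f x).
Proof.
  intros [_ H] Hx; destruct (H x Hx) as (z & Hz & Hu).
  assert (E : app f x = z).
  { apply the_eq; [now apply maps_iff|].
    intros w Hw; symmetry; apply Hu; now apply maps_iff. }
  rewrite E; split; [intros K; symmetry; auto | intros ->; exact Hz].
Qed.

Lemma app_codomain (f : M) (A B : M -> Prop) (x : M) :
  is_function f A B -> A x -> B (app f x).
Proof.
  intros H Hx; assert (K : maps f x (app f x)) by now apply (maps_app f A B).
  apply maps_iff in K; destruct H as [H _].
  apply H in K as (x' & y & _ & Hy & E).
  apply opair_iff, opair_inj in E as [_ ->]; exact Hy.
Qed.

Ltac definable_constant ::=
  match goal with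
  | |- term (fun e => opair _ _) => apply term_opair
  | |- term (fun e => upair _ _) => apply term_upair
  | |- term (fun e => app _ _) => apply term_app
  | |- term (fun e => sep _ _) => apply term_sep
  | |- term (fun e => image _ _) => apply term_image
  | |- term (fun e => graph _ _) => apply term_graph
  | |- definable (fun e => subset _ _) => unfold subset
  | |- definable (fun e => ordinal _) =>
      unfold ordinal, transitive_set, well_ordered_by_mem, subset
  end.

(** * Ordinals *)

Lemma foundation (P : M -> Prop) (a x : M) : definable1 P -> x ∈ a -> P x ->
  exists y, y ∈ a /\ P y /\ forall z, z ∈ y -> z ∈ a -> ~ P z.
Proof.
  intros HP Hx Px.
  destruct (zf_foundation M hZF (sep a P)) as (y & Hy & Hmin).
  - exists x; now apply sep_spec.
  - apply sep_spec in Hy as [Hy Py]; [|exact HP].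
    exists y; split; [exact Hy|split; [exact Py|]].
    intros z Hz Hza Pz; apply (Hmin z Hz); now apply sep_spec.
Qed.

Lemma mem_irrefl (x : M) : ~ x ∈ x.
Proof.
  intros H.
  destruct (foundation (fun y => y = x) (upair x x) x) as (y & _ & -> & Hy).
  - definability.
  - apply upair_spec; tauto.
  - reflexivity.
  - apply (Hy x H); [apply upair_spec; tauto | reflexivity].
Qed.

Lemma ordinal_trans (a x y : M) : ordinal a -> x ∈ a -> y ∈ x -> y ∈ a.
Proof. intros [H _] Hx; exact (H x Hx y). Qed.

Lemma ordinal_mem (a x : M) : ordinal a -> x ∈ a -> ordinal x.
Proof.
  intros [Ht (H1 & H2 & H3 & H4)] Hx.
  assert (Hsub : forall y, y ∈ x -> y ∈ a) by (intros y; apply (Ht x Hx)).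
  split.
  - intros y Hy z Hz; apply (H2 z y x); auto.
    now apply (Ht y); auto.
  - split; [|split; [|split]]; eauto.
    intros b Hb; apply H4; intros y Hy; auto.
Qed.

(** Foundation yields a minimal counterexample below [a]; by transitivity of [a] it is minimal among
    all its own elements too. *)
Lemma ordinal_induction (P : M -> Prop) : definable1 P ->
  (forall a, ordinal a -> (forall b, b ∈ a -> P b) -> P a) ->
  forall a, ordinal a -> P a.
Proof.
  intros HP IH a Ha.
  apply IH; [exact Ha|]; intros b Hb.
  apply NNPP; intros Pb.
  destruct (foundation (fun x => ~ P x) a b) as (y & Hy & Py & Hmin); auto.
  { definability. }
  apply Py, IH; [now apply (ordinal_mem a)|].
  intros z Hz; apply NNPP; apply Hmin; [exact Hz|].
  now apply (ordinal_trans a y).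
Qed.

(** If [c] is not all of [a], a minimal element of the difference has exactly the elements of
    [c]. *)
Lemma transitive_subset_ordinal (a c : M) : ordinal a -> transitive_set c ->
  subset c a -> c = a \/ c ∈ a.
Proof.
  intros Ha Hc Hca.
  destruct (classic (exists x, x ∈ a /\ ~ x ∈ c)) as [(x & Hx & Hxc)|H].
  - right.
    destruct (foundation (fun y => ~ y ∈ c) a x) as (m & Hm & Hmc & Hmin); auto.
    { definability. }
    replace c with m; [exact Hm|].
    apply set_ext; intros y; split; intros Hy.
    + apply NNPP; apply Hmin; [exact Hy|]; now apply (ordinal_trans a m).
    + destruct (proj2 Ha) as (_ & _ & H3 & _).
      destruct (H3 y m (Hca y Hy) Hm) as [H|[->|H]]; [exact H|tauto|].
      exfalso; apply Hmc, (Hc y Hy m H).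
  - left; apply set_ext; intros y; split; [apply Hca|].
    intros Hy; apply NNPP; eauto.
Qed.

(** The intersection [c] is a transitive subset of both ordinals, hence equal to or a member of
    each; membership in both would give [c ∈ c]. *)
Lemma ordinal_trichotomy (a b : M) :
  ordinal a -> ordinal b -> a ∈ b \/ a = b \/ b ∈ a.
Proof.
  intros Ha Hb.
  assert (Hd : definable1 (fun x => x ∈ b)) by definability.
  pose (c := sep a (fun x => x ∈ b)).
  assert (Hc : forall x, x ∈ c <-> x ∈ a /\ x ∈ b) by now apply sep_spec.
  assert (Ht : transitive_set c).
  { intros x Hx y Hy; apply Hc in Hx as [H1 H2]; apply Hc.
    split; [now apply (ordinal_trans a x) | now apply (ordinal_trans b x)]. }
  destruct (transitive_subset_ordinal a c Ha Ht) as [Ea|Ea].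
  { intros x Hx; now apply Hc in Hx. }
  all: destruct (transitive_subset_ordinal b c Hb Ht) as [Eb|Eb].
  all: try (intros x Hx; now apply Hc in Hx).
  - right; left; congruence.
  - left; congruence.
  - right; right; congruence.
  - exfalso; apply (mem_irrefl c), Hc; tauto.
Qed.

Lemma ordinal_subset_or_mem (a b : M) :
  ordinal a -> ordinal b -> subset a b \/ b ∈ a.
Proof.
  intros Ha Hb; destruct (ordinal_trichotomy a b Ha Hb) as [H|[->|H]].
  - left; intros x Hx; now apply (ordinal_trans b a).
  - left; intros x Hx; exact Hx.
  - now right.
Qed.

Lemma ordinal_intro (a : M) :
  transitive_set a -> (forall x, x ∈ a -> ordinal x) -> ordinal a.
Proof.
  intros Ht Ho; split; [exact Ht|].
  split; [|split; [|split]].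
  - intros x _; apply mem_irrefl.
  - intros x y z _ _ Hz Hxy Hyz; exact (ordinal_trans z y x (Ho z Hz) Hyz Hxy).
  - intros x y Hx Hy; apply ordinal_trichotomy; auto.
  - intros b Hb [x Hx].
    destruct (foundation (fun _ => True) b x) as (m & Hm & _ & Hmin); auto.
    { apply definable_ext with (fun e : nat -> M => e 0 = e 0); [tauto|].
      definability. }
    exists m; split; [exact Hm|]; intros y Hy.
    destruct (ordinal_trichotomy m y) as [H|[H|H]]; auto.
    exfalso; exact (Hmin y H Hy I).
Qed.

(** * Hartogs numbers *)

Definition embeds (F : M -> M) (a X : M) : Prop :=
  (forall x, x ∈ a -> F x ∈ X) /\
  (forall x y, x ∈ a -> y ∈ a -> F x = F y -> x = y).

(* An embedding [F] of [a] into [X] turns [a] into the chain of the sets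
   [F[b]], for [b] in [a]; the chain determines [a]. *)
Lemma chain_determines_ordinal (a a' X X' : M) (F F' : M -> M) :
  function1 F -> function1 F' -> ordinal a -> ordinal a' ->
  embeds F a X -> embeds F' a' X' ->
  image a (fun b => image b F) = image a' (fun b => image b F') ->
  a = a'.
Proof.
  intros HF HF'.
  assert (HI : function1 (fun b => image b F)) by definability.
  assert (HI' : function1 (fun b => image b F')) by definability.
  (* Distinct members of [a] have distinct images: if [b ∈ c] and the images agree, then [G b = G x]
     for some [x ∈ b], against injectivity. *)
  assert (mono : forall G a X b c, function1 G -> ordinal a -> embeds G a X ->
    b ∈ a -> c ∈ a -> image b G = image c G -> b = c).
  { intros G d Y b c HG Hd [_ inj] Hb Hc E.
    assert (K : forall b c, b ∈ d -> c ∈ d -> image b G = image c G -> ~ b ∈ c).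
    { clear b c Hb Hc E; intros b c Hb Hc E H.
      assert (L : G b ∈ image b G) by (rewrite E; apply image_spec; eauto).
      apply image_spec in L as (x & Hx & L); [|exact HG].
      apply inj in L; auto; [subst x; exact (mem_irrefl b Hx)|].
      now apply (ordinal_trans d b). }
    destruct (ordinal_trichotomy b c) as [H|[H|H]]; eauto using ordinal_mem.
    - exfalso; exact (K b c Hb Hc E H).
    - exfalso; exact (K c b Hc Hb (eq_sym E) H). }
  assert (sub : forall G b c, function1 G -> (forall x, x ∈ b -> x ∈ c) ->
    subset (image b G) (image c G)).
  { intros G b c HG H y Hy; apply image_spec in Hy as (x & Hx & ->); [|exact HG].
    apply image_spec; eauto. }
  assert (half : forall a a' X X' F F', function1 F -> function1 F' ->
    ordinal a -> ordinal a' -> embeds F a X -> embeds F' a' X' ->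
    image a (fun b => image b F) = image a' (fun b => image b F') -> ~ a ∈ a').
  { clear a a' X X' F F' HF HF' HI HI'.
    intros a a' X X' F F' HF HF' Ha Ha' E E' EQ Haa'.
    assert (HI : function1 (fun b => image b F)) by definability.
    assert (HI' : function1 (fun b => image b F')) by definability.
    (* [F[b]] occurs in the second chain as some [F'[c]]. If [c ∈ b], induction gives [F[c] = F[b]],
       against [mono]. If [b ∈ c], then [F'[b]] lies inside [F[b]] and equals some [F[d]]; either
       [b] is a subset of [d], which gives the other inclusion, or [d ∈ b], which again contradicts
       [mono]. *)
    assert (agree : forall b, ordinal b -> b ∈ a -> image b F = image b F').
    { apply (ordinal_induction (fun b => b ∈ a -> image b F = image b F')).
      { definability. }
      intros b Hob IH Hb.
      assert (Hb' : b ∈ a') by now apply (ordinal_trans a' a).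
      assert (K : image b F ∈ image a (fun b => image b F))
        by (apply image_spec; eauto).
      rewrite EQ in K; apply image_spec in K as (c & Hc & K); [|exact HI'].
      assert (Hoc : ordinal c) by now apply (ordinal_mem a').
      destruct (ordinal_trichotomy b c) as [H|[->|H]]; auto.
      - assert (L : image b F' ∈ image a' (fun b => image b F'))
          by (apply image_spec; eauto).
        rewrite <- EQ in L; apply image_spec in L as (d & Hd & L); [|exact HI].
        assert (Hod : ordinal d) by now apply (ordinal_mem a).
        assert (S1 : subset (image b F') (image b F)).
        { rewrite K; apply sub; [exact HF'|].
          intros x Hx; now apply (ordinal_trans c b). }
        destruct (ordinal_subset_or_mem b d) as [S|S]; auto.
        + apply set_ext; intros x; split; [|apply S1].
          rewrite L; now apply sub.
        + assert (Hda : d ∈ a') by now apply (ordinal_trans a' b).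
          rewrite (IH d S Hd) in L.
          apply (mono F' a' X') in L; auto.
          subst d; exfalso; exact (mem_irrefl b S).
      - assert (Hca : c ∈ a) by now apply (ordinal_trans a b).
        rewrite <- (IH c H Hca) in K.
        apply (mono F a X) in K; auto.
        subst c; exfalso; exact (mem_irrefl b H). }
    (* As a member of the second chain, [F'[a]] is some [F[b] = F'[b]] with [b ∈ a], contradicting
       [mono]. *)
    assert (K : image a F' ∈ image a' (fun b => image b F'))
      by (apply image_spec; eauto).
    rewrite <- EQ in K; apply image_spec in K as (b & Hb & K); [|exact HI].
    rewrite agree in K; [|now apply (ordinal_mem a)|exact Hb].
    apply (mono F' a' X') in K; auto; [|now apply (ordinal_trans a' a)].
    subst b; exact (mem_irrefl a Hb). }
  intros Ha Ha' E E' EQ.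
  destruct (ordinal_trichotomy a a' Ha Ha') as [H|[H|H]]; [|exact H|].
  - exfalso; exact (half a a' X X' F F' HF HF' Ha Ha' E E' EQ H).
  - exfalso; exact (half a' a X' X F' F HF' HF Ha' Ha E' E (eq_sym EQ) H).
Qed.

(** [lam] is the set of all ordinals that embed into [X]. It is a set by Replacement: the chain of
    an embedding lies in the double power set of [X] and determines the ordinal. An embedding of
    [lam] itself would put [lam] into [lam]. *)
Lemma hartogs (X : M) : exists lam, cardinal lam /\
  forall F, function1 F -> ~ embeds F lam X.
Proof.
  assert (Happ : forall f, function1 (app f)).
  { intros f; apply (term_app (fun _ => f)); definability. }
  assert (Hch : forall f, function1 (fun b => image b (app f))).
  { intros f; specialize (Happ f); definability. }
  destruct (replacement (fun C a => ordinal a /\ exists f,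
      embeds (app f) a X /\ C = image a (fun b => image b (app f)))
    (power (power X))) as [lam Hlam].
  { unfold embeds; definability. }
  { intros C a a' _ (Ha & f & E & EC) (Ha' & f' & E' & EC').
    apply (chain_determines_ordinal a a' X X (app f) (app f')); auto.
    congruence. }
  assert (Hiff : forall a, a ∈ lam <-> ordinal a /\ exists f, embeds (app f) a X).
  { intros a; rewrite Hlam; split.
    - intros (C & _ & Ha & f & E & _); eauto.
    - intros (Ha & f & E).
      exists (image a (fun b => image b (app f))); split; [|eauto].
      apply power_spec; intros s Hs; apply image_spec in Hs as (b & Hb & ->); auto.
      apply power_spec; intros y Hy; apply image_spec in Hy as (x & Hx & ->); auto.
      apply E; now apply (ordinal_trans a b). }
  assert (Ho : ordinal lam).
  { apply ordinal_intro; [|intros x Hx; now apply Hiff].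
    intros a Ha b Hb; apply Hiff in Ha as (Ha & f & E1 & E2).
    apply Hiff; split; [now apply (ordinal_mem a)|].
    exists f; split; intros; [apply E1 | apply E2]; eauto using ordinal_trans. }
  assert (Hno : forall F, function1 F -> ~ embeds F lam X).
  { intros F HF [E1 E2]; apply (mem_irrefl lam), Hiff; split; [exact Ho|].
    exists (graph F lam).
    split; intros; rewrite app_graph in * by auto; auto.
    rewrite app_graph in * by auto; auto. }
  exists lam; split; [split; [exact Ho|] | exact Hno].
  intros a Ha (f & Hf & Hbij).
  apply Hiff in Ha as (Hoa & g & E1 & E2).
  assert (Hinv : forall y, y ∈ lam ->
    the (fun x => opair x y ∈ f) ∈ a /\
    opair (the (fun x => opair x y ∈ f)) y ∈ f).
  { intros y Hy; destruct (Hbij y Hy) as (x & Hx & Hu); apply maps_iff in Hx.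
    rewrite (the_eq _ x Hx);
      [| intros z Hz; symmetry; apply Hu; now apply maps_iff].
    split; [|exact Hx].
    destruct Hf as [Hf _]; apply Hf in Hx as (x' & y' & Hx' & _ & E).
    apply opair_iff, opair_inj in E as [-> _]; exact Hx'. }
  (* A bijection [f] from a smaller [a] onto [lam], inverted and followed by the embedding [g] of
     [a], would embed [lam] into [X]. *)
  apply (Hno (fun y => app g (the (fun x => opair x y ∈ f)))).
  - apply term_app; [definability|].
    apply (term_the (fun x e => opair x (e 0) ∈ f)); definability.
  - split; intros y.
    + intros Hy; apply E1, Hinv, Hy.
    + intros z Hy Hz H; apply Hinv in Hy as [Hy1 Hy2], Hz as [Hz1 Hz2].
      apply E2 in H; auto; rewrite H in Hy2.
      assert (K : forall w, opair (the (fun x => opair x z ∈ f)) w ∈ f ->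
        w = app f (the (fun x => opair x z ∈ f))).
      { intros w Hw; apply maps_iff in Hw.
        now apply (maps_app f (elements a) (elements lam)) in Hw. }
      rewrite (K y Hy2) at 1; symmetry; exact (K z Hz2).
Qed.
Lemma function1_app (f : M) : function1 (app f).
Proof. apply (term_app (fun _ => f)); definability. Qed.

(** * Recursion on ordinals *)

(** The value at [a] is read off the unique set function on [a] that obeys the recursion. Its
    existence follows by induction, since the graph of [G] on [a] is such a function. *)
Lemma ordinal_recursion (F : M -> M -> M) : function2 F ->
  exists G, function1 G /\ forall a, ordinal a -> G a = F a (graph G a).
Proof.
  intros HF.
  assert (Happ := function1_app).
  (* The first clause makes [f] a function with domain exactly [a], so that agreement of values
     implies equality of sets. *)
  pose (approx a f := f = graph (app f) a /\
    forall x, x ∈ a -> app f x = F x (graph (app f) x)).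
  assert (Hd : definable2 approx).
  { unfold approx; definability. }
  assert (agree : forall a f f', approx a f -> approx a f' ->
    forall x, ordinal x -> subset x a -> x ∈ a -> app f x = app f' x).
  { intros a f f' [_ H] [_ H'].
    apply (ordinal_induction (fun x => subset x a -> x ∈ a -> app f x = app f' x)).
    { definability. }
    intros x Hx IH Hxa Hx'.
    rewrite (H x), (H' x) by auto; f_equal; apply graph_ext; auto.
    intros y Hy; apply IH; auto.
    intros z Hz; apply Hxa; now apply (ordinal_trans x y). }
  assert (uniq : forall a f f', ordinal a -> approx a f -> approx a f' -> f = f').
  { intros a f f' Ha H H'.
    rewrite (proj1 H), (proj1 H'); apply graph_ext; auto.
    intros x Hx; apply (agree a); auto.
    - now apply (ordinal_mem a).
    - intros y Hy; now apply (ordinal_trans a x). }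
  pose (G a := the (fun z => exists f, approx a f /\ z = F a f)).
  assert (HG : function1 G).
  { apply (term_the (fun z e => exists f, approx (e 0) f /\ z = F (e 0) f)).
    definability. }
  assert (GE : forall a f, ordinal a -> approx a f -> G a = F a f).
  { intros a f Ha H; apply the_eq; [eauto|].
    intros z (f' & H' & ->); now rewrite (uniq a f f'). }
  assert (all : forall a, ordinal a -> approx a (graph G a)).
  { apply ordinal_induction.
    { definability. }
    intros a Ha IH; split.
    - apply graph_ext; auto; intros x Hx; now rewrite app_graph.
    - intros x Hx; rewrite app_graph by auto.
      assert (Hox : ordinal x) by now apply (ordinal_mem a).
      rewrite (GE x _ Hox (IH x Hx)); f_equal.
      apply graph_ext; auto; intros y Hy; rewrite app_graph; auto.
      now apply (ordinal_trans a x). }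
  exists G; split; [exact HG|]; auto.
Qed.

(** This is the Mostowski collapse of [E] on the ordinals: the recursion sends [a] to the set of
    values at its [E]-predecessors. *)
Lemma rank_exists (E : M -> M -> Prop) : definable2 E ->
  exists r, function1 r /\ forall a, ordinal a ->
    forall z, z ∈ r a <-> exists x, x ∈ a /\ E x a /\ z = r x.
Proof.
  intros HE.
  destruct (ordinal_recursion
    (fun a g => image (sep a (fun x => E x a)) (app g))) as (r & Hr & Hrec).
  { definability. }
  exists r; split; [exact Hr|]; intros a Ha z.
  rewrite (Hrec a Ha), image_spec by apply function1_app.
  assert (Hs : forall x, x ∈ sep a (fun x => E x a) <-> x ∈ a /\ E x a)
    by (apply sep_spec; definability).
  split.
  - intros (x & Hx & ->); apply Hs in Hx as [Hx Ex].
    exists x; rewrite app_graph by assumption; auto.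
  - intros (x & Hx & Ex & ->); exists x.
    rewrite Hs, app_graph by assumption; auto.
Qed.

(** Transitivity of [E] makes each collapse value a transitive set, and its elements are ordinals by
    induction. *)
Lemma rank_ordinal (E : M -> M -> Prop) (r : M -> M) : function1 r ->
  (forall x y z, E x y -> E y z -> E x z) ->
  (forall x y, E x y -> x ∈ y) ->
  (forall a, ordinal a -> forall z,
    z ∈ r a <-> exists x, x ∈ a /\ E x a /\ z = r x) ->
  forall a, ordinal a -> ordinal (r a).
Proof.
  intros Hr Htr Hmem Hrank.
  apply ordinal_induction.
  { definability. }
  intros a Ha IH; apply ordinal_intro.
  - intros z Hz w Hw.
    apply Hrank in Hz as (x & Hx & Ex & ->); [|exact Ha].
    apply Hrank in Hw as (y & Hy & Ey & ->); [|now apply (ordinal_mem a)].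
    apply Hrank; [exact Ha|]; exists y; eauto 8.
  - intros z Hz; apply Hrank in Hz as (x & Hx & _ & ->); auto.
Qed.

(** * The Erdős–Rado tree of a colouring *)

(* [E x y] says that [x] precedes [y] in the tree; [c x y] is the colour of
   the pair. *)
Definition colouring_tree (lam : M) (c : M -> M -> M) (E : M -> M -> Prop) :=
  forall x y, E x y <->
    x ∈ lam /\ y ∈ lam /\ x ∈ y /\ forall z, E z x -> c z x = c z y.

(** The recursion builds the set [G x] of tree successors of [x]. The nodes preceding [x] are the
    [z ∈ x] with [x ∈ G z], so only earlier values are consulted. *)
Lemma colouring_tree_exists (lam : M) (c : M -> M -> M) :
  ordinal lam -> function2 c ->
  exists E, definable2 E /\ colouring_tree lam c E.
Proof.
  intros Hlam Hc.
  destruct (ordinal_recursion (fun x g => sep lam (fun y => x ∈ y /\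
    forall z, z ∈ x -> x ∈ app g z -> c z x = c z y))) as (G & HG & Hrec).
  { definability. }
  assert (HE : forall x y, x ∈ lam -> y ∈ G x <-> y ∈ lam /\ x ∈ y /\
    forall z, z ∈ x -> x ∈ G z -> c z x = c z y).
  { intros x y Hx; rewrite Hrec by now apply (ordinal_mem lam).
    rewrite sep_spec by definability.
    split; intros (H1 & H2 & H3); repeat split; auto; intros z Hz Hzx;
      apply H3; auto; rewrite app_graph in *; auto. }
  exists (fun x y => x ∈ lam /\ y ∈ G x); split; [definability|].
  intros x y; split.
  - intros [Hx Hy]; apply HE in Hy as (Hy & Hxy & H); auto.
    repeat split; auto; intros z [Hz Hzx]; apply H; auto.
    now apply HE in Hzx as (_ & Hzx & _).
  - intros (Hx & Hy & Hxy & H); split; [exact Hx|]; apply HE; auto.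
    repeat split; auto; intros z Hz Hzx; apply H; split; auto.
    now apply (ordinal_trans lam x).
Qed.

(** By induction on [x]: a [w] preceding [x] also precedes [y], so [c w x = c w y = c w z]. *)
Lemma colouring_tree_trans (lam : M) (c : M -> M -> M) (E : M -> M -> Prop) :
  ordinal lam -> definable2 E -> colouring_tree lam c E ->
  forall x y z, E x y -> E y z -> E x z.
Proof.
  intros Hlam HE HT.
  assert (K : forall x, ordinal x -> forall y z, E x y -> E y z -> E x z).
  { apply (ordinal_induction (fun x => forall y z, E x y -> E y z -> E x z));
      [definability|].
    intros x Hx IH y z Hxy Hyz; apply HT.
    pose proof (proj1 (HT _ _) Hxy) as (Hxl & Hyl & Hxy' & Hcxy).
    pose proof (proj1 (HT _ _) Hyz) as (_ & Hzl & Hyz' & Hcyz).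
    repeat split; auto.
    - apply (ordinal_trans z y); auto; now apply (ordinal_mem lam).
    - intros w Hw; rewrite (Hcxy w Hw); apply Hcyz.
      apply (IH w) with x; auto; now apply HT in Hw. }
  intros x y z Hxy; apply K; auto.
  apply HT in Hxy; now apply (ordinal_mem lam).
Qed.

(** By induction on [x]: a [w] preceding [x] precedes [z] by transitivity and [y] by induction, so
    [c w x = c w z = c w y]. *)
Lemma colouring_tree_linear (lam : M) (c : M -> M -> M) (E : M -> M -> Prop) :
  ordinal lam -> definable2 E -> colouring_tree lam c E ->
  forall x y z, E x z -> E y z -> x ∈ y -> E x y.
Proof.
  intros Hlam HE HT x y z Hxz Hyz.
  assert (Htr := colouring_tree_trans lam c E Hlam HE HT).
  pose proof (proj1 (HT _ _) Hyz) as (Hyl & _ & _ & Hcyz).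
  assert (K : forall x, ordinal x -> E x z -> x ∈ y -> E x y).
  { clear x Hxz; apply (ordinal_induction (fun x => E x z -> x ∈ y -> E x y));
      [definability|].
    intros x Hx IH Hxz Hxy.
    pose proof (proj1 (HT _ _) Hxz) as (Hxl & _ & _ & Hcxz).
    apply HT; repeat split; auto.
    intros w Hw; rewrite (Hcxz w Hw); symmetry; apply Hcyz.
    assert (w ∈ x) by now apply HT in Hw.
    apply IH; eauto.
    apply (ordinal_trans y x); auto; now apply (ordinal_mem lam). }
  apply K; auto; apply HT in Hxz; now apply (ordinal_mem lam).
Qed.

(* If every node has rank in [theta], then sending a node [a] to the set of
   pairs (rank of [x], colour of [{x, a}]), for [x] below [a], embeds [lam]
   into the power set of [theta] x [mu]. *)
Lemma colouring_tree_high (lam theta mu : M) (c : M -> M -> M)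
    (E : M -> M -> Prop) (t : M -> M) :
  ordinal lam -> function2 c -> definable2 E -> colouring_tree lam c E ->
  (forall x y, x ∈ lam -> y ∈ lam -> x ∈ y -> c x y ∈ mu) ->
  function1 t ->
  (forall a, ordinal a -> forall z,
    z ∈ t a <-> exists x, x ∈ a /\ E x a /\ z = t x) ->
  (forall F, function1 F -> ~ embeds F lam (power (prod theta mu))) ->
  exists a, a ∈ lam /\ ~ t a ∈ theta.
Proof.
  intros Hlam Hc HE HT Hmu Ht Hrank Hno.
  assert (Htr := colouring_tree_trans lam c E Hlam HE HT).
  assert (Hlin := colouring_tree_linear lam c E Hlam HE HT).
  assert (Hord : forall a, a ∈ lam -> ordinal a)
    by exact (fun a => ordinal_mem lam a Hlam).
  apply NNPP; intros Hlow.
  assert (Hth : forall a, a ∈ lam -> t a ∈ theta).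
  { intros a Ha; apply NNPP; eauto. }
  assert (Hinc : forall x a, E x a -> t x ∈ t a).
  { intros x a H; pose proof (proj1 (HT _ _) H) as (Hx & Ha & Hxa & _).
    apply Hrank; eauto. }
  pose (S a := image (sep a (fun x => E x a)) (fun x => opair (t x) (c x a))).
  assert (HS : function1 S) by (unfold S; definability).
  assert (HSE : forall a, a ∈ lam -> forall p, p ∈ S a <->
    exists x, E x a /\ p = opair (t x) (c x a)).
  { intros a Ha p; unfold S; rewrite image_spec by definability.
    split; intros (x & Hx & ->); exists x; split; auto.
    - now apply sep_spec in Hx; [|definability].
    - apply sep_spec; [definability|]; split; [now apply HT in Hx|auto]. }
  (* The first coordinates of [S a] form the rank of [a], so the ranks of [a] and [a'] agree. But
     equal colours below [a] would make [a] precede [a'], forcing [t a ∈ t a']. *)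
  assert (Hnot : forall a a', a ∈ lam -> a' ∈ lam -> S a = S a' -> ~ a ∈ a').
  { intros a a' Ha Ha' HSS Haa'.
    assert (Hta : t a = t a').
    { assert (K : forall a a', a ∈ lam -> a' ∈ lam -> S a = S a' ->
        subset (t a) (t a')).
      { clear a a' Ha Ha' HSS Haa'; intros a a' Ha Ha' HSS z Hz.
        apply Hrank in Hz as (x & _ & Hx & ->); auto.
        assert (L : opair (t x) (c x a) ∈ S a') by (rewrite <- HSS; apply HSE; eauto).
        apply HSE in L as (x' & Hx' & L); auto.
        apply opair_inj in L as [-> _]; auto. }
      apply set_ext; intros z; split; apply K; auto. }
    apply (mem_irrefl (t a)); rewrite Hta at 2; apply Hinc, HT.
    repeat split; auto.
    assert (K : forall x, ordinal x -> E x a -> c x a = c x a').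
    { apply (ordinal_induction (fun x => E x a -> c x a = c x a'));
        [definability|].
      intros x Hx IH Hxa.
      pose proof (proj1 (HT _ _) Hxa) as (Hxl & _ & Hxa' & Hcx).
      assert (Hxa2 : E x a').
      { apply HT; repeat split; auto.
        - apply (ordinal_trans a' a); auto.
        - intros w Hw; rewrite (Hcx w Hw); apply IH; eauto.
          now apply HT in Hw. }
      (* This pair comes from some [x'] preceding [a] with the rank of [x]. Ranks increase strictly
         along the linearly ordered predecessors of [a], so [x' = x] and the colours agree. *)
      assert (L : opair (t x) (c x a') ∈ S a) by (rewrite HSS; apply HSE; eauto).
      apply HSE in L as (x' & Hx' & L); auto.
      apply opair_inj in L as [Htx Hcc].
      pose proof (proj1 (HT _ _) Hx') as (Hxl' & _ & _ & _).
      destruct (ordinal_trichotomy x x') as [H|[->|H]]; auto.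
      - exfalso; apply (mem_irrefl (t x)); rewrite Htx at 2; eauto.
      - exfalso; apply (mem_irrefl (t x)); rewrite Htx at 1; eauto. }
    intros x Hx; apply K; auto; apply HT in Hx; apply Hord; tauto. }
  apply (Hno S HS); split.
  - intros a Ha; apply power_spec; intros p Hp.
    apply HSE in Hp as (x & Hx & ->); auto.
    apply HT in Hx as (Hx & _ & Hxa & _); apply prod_spec; auto.
  - intros a a' Ha Ha' HSS.
    destruct (ordinal_trichotomy a a') as [H|[H|H]]; auto.
    + exfalso; exact (Hnot a a' Ha Ha' HSS H).
    + exfalso; exact (Hnot a' a Ha' Ha (eq_sym HSS) H).
Qed.

(* The set [H] is the initial segment of length [kappa] of a colour class
   {x : E x a /\ c x a = i}, cut off at a member [b] of large rank in it. *)
Lemma high_node_homogeneous (lam theta mu kappa a : M) (c : M -> M -> M)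
    (E : M -> M -> Prop) (t : M -> M) :
  ordinal lam -> ordinal theta -> ordinal kappa ->
  function2 c -> definable2 E -> colouring_tree lam c E ->
  (forall x y, x ∈ lam -> y ∈ lam -> x ∈ y -> c x y ∈ mu) ->
  function1 t ->
  (forall a, ordinal a -> forall z,
    z ∈ t a <-> exists x, x ∈ a /\ E x a /\ z = t x) ->
  (forall F, function1 F -> ~ embeds F theta (prod mu kappa)) ->
  a ∈ lam -> ~ t a ∈ theta ->
  exists H i, subset H lam /\ equinumerous H kappa /\
    forall x y, x ∈ H -> y ∈ H -> x ∈ y -> c x y = i.
Proof.
  intros Hlam Htheta Hkappa Hc HE HT Hmu Ht Hrank Hno Ha Hhigh.
  assert (Htr := colouring_tree_trans lam c E Hlam HE HT).
  assert (Hlin := colouring_tree_linear lam c E Hlam HE HT).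
  assert (Hord : forall a, a ∈ lam -> ordinal a)
    by exact (fun a => ordinal_mem lam a Hlam).
  assert (Hsub : subset theta (t a)).
  { destruct (ordinal_subset_or_mem theta (t a)) as [H|H]; auto; [|tauto].
    apply (rank_ordinal E); auto; intros x y H; now apply HT in H. }
  assert (HEl : forall x, E x a -> x ∈ lam) by (intros x H; now apply HT in H).
  (* [E'] orders each colour class of predecessors of [a] separately, so its rank [r] is the
     position within the class. *)
  pose (E' x y := E x a /\ E y a /\ x ∈ y /\ c x a = c y a).
  assert (HE' : definable2 E') by (unfold E'; definability).
  destruct (rank_exists E' HE') as (r & Hr & Hrank').
  assert (Hinc : forall x y, E' x y -> r x ∈ r y).
  { intros x y H; apply Hrank'; [apply Hord, HEl, H|].
    exists x; repeat split; auto; apply H. }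
  assert (Hinj : forall x y, E x a -> E y a -> c x a = c y a -> r x = r y -> x = y).
  { intros x y Hx Hy Hcc Hrr.
    destruct (ordinal_trichotomy x y) as [H|[H|H]]; auto.
    - exfalso; apply (mem_irrefl (r x)); rewrite Hrr at 2.
      apply Hinc; repeat split; auto.
    - exfalso; apply (mem_irrefl (r x)); rewrite Hrr at 1.
      apply Hinc; repeat split; auto. }
  assert (Hb : exists b, E b a /\ ~ r b ∈ kappa).
  { apply NNPP; intros Hlow.
    (* [g z] is the predecessor of [a] of rank [z]. If all positions were below [kappa], colour and
       position of [g z] would embed [theta] into [prod mu kappa]. *)
    pose (g z := the (fun x => E x a /\ z = t x)).
    assert (Hg : function1 g).
    { apply (term_the (fun x e => E x a /\ e 0 = t x)); definability. }
    assert (Hgs : forall z, z ∈ theta -> E (g z) a /\ z = t (g z)).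
    { intros z Hz; apply Hsub, Hrank in Hz as (x & _ & Hx & ->); auto.
      apply (the_holds (fun y => E y a /\ t x = t y) x); auto.
      intros y [Hy Hxy].
      destruct (ordinal_trichotomy x y) as [H|[H|H]]; auto;
        exfalso; apply (mem_irrefl (t x)).
      - rewrite Hxy at 2; apply Hrank; eauto.
      - rewrite Hxy at 1; apply Hrank; eauto 6. }
    apply (Hno (fun z => opair (c (g z) a) (r (g z)))); [definability|split].
    - intros z Hz; destruct (Hgs z Hz) as [Hz1 _]; apply prod_spec.
      + apply HT in Hz1; apply Hmu; tauto.
      + apply NNPP; eauto.
    - intros z w Hz Hw Hzw; apply opair_inj in Hzw as [H1 H2].
      destruct (Hgs z Hz) as [Hz1 ->], (Hgs w Hw) as [Hw1 ->].
      now rewrite (Hinj (g z) (g w)). }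
  destruct Hb as (b & Hb & Hrb).
  assert (Hkb : subset kappa (r b)).
  { destruct (ordinal_subset_or_mem kappa (r b)) as [H|H]; auto; [|tauto].
    apply (rank_ordinal E'); auto; unfold E'.
    - intros x y z (H1 & H2 & H3 & H4) (H5 & H6 & H7 & H8).
      repeat split; auto; [|congruence].
      apply (ordinal_trans z y); auto.
    - tauto. }
  pose (H := sep lam (fun x => E' x b /\ r x ∈ kappa)).
  assert (HH : forall x, x ∈ H <-> x ∈ lam /\ E' x b /\ r x ∈ kappa)
    by (apply sep_spec; definability).
  exists H, (c b a); split; [|split].
  - intros x Hx; now apply HH in Hx.
  - assert (Hmaps : forall x y, maps (graph r H) x y <-> x ∈ H /\ y = r x).
    { intros x y; rewrite maps_iff; now apply graph_spec. }
    exists (graph r H); split; [split|].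
    + intros p Hp; apply image_spec in Hp as (x & Hx & ->); [|definability].
      exists x, (r x); rewrite opair_iff; repeat split; auto.
      apply HH in Hx; apply Hx.
    + intros x Hx; exists (r x); split; [now apply Hmaps|].
      intros y Hy; symmetry; now apply Hmaps.
    + intros z Hz; destruct (proj1 (Hrank' b (Hord b (HEl b Hb)) z) (Hkb z Hz))
        as (x & _ & Hx & ->).
      assert (Hxl : x ∈ lam) by apply HEl, Hx.
      exists x; split; [apply Hmaps; rewrite HH; auto|].
      intros y Hy; apply Hmaps in Hy as [Hy Hxy]; apply HH in Hy as (_ & Hy & _).
      destruct Hx as (Hx & _ & _ & Hcx), Hy as (Hy & _ & _ & Hcy).
      apply Hinj; congruence.
  - intros x y Hx Hy Hxy.
    apply HH in Hx as (_ & (Hx & _ & _ & Hcx) & _).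
    apply HH in Hy as (_ & (Hy & _) & _).
    (* By linearity [x] precedes [y], and [y] precedes [a], so [c x y = c x a], the colour of the
       class. *)
    rewrite <- Hcx; pose proof (proj1 (HT _ _) Hy) as (_ & _ & _ & K).
    apply K; eauto.
Qed.

(** * The partition relation *)

Lemma erdos_rado (kappa mu : M) : ordinal kappa ->
  exists lam, cardinal lam /\ arrow2 lam kappa mu.
Proof.
  intros Hkappa.
  destruct (hartogs (prod mu kappa)) as (theta & Htheta & Hno).
  destruct (hartogs (power (prod theta mu))) as (lam & Hlam & Hno').
  exists lam; split; [exact Hlam|]; intros f Hf.
  destruct Hlam as [Hlam _], Htheta as [Htheta _].
  pose (c x y := app f (upair x y)).
  assert (Hc : function2 c) by (unfold c; definability).
  assert (Hpair : forall x y, x ∈ lam -> y ∈ lam -> x ∈ y ->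
    pairs lam (upair x y)).
  { intros x y Hx Hy Hxy; exists x, y; rewrite upair_iff.
    repeat split; auto; intros ->; exact (mem_irrefl y Hxy). }
  assert (Hmu : forall x y, x ∈ lam -> y ∈ lam -> x ∈ y -> c x y ∈ mu).
  { intros x y Hx Hy Hxy.
    apply (app_codomain f (pairs lam) (elements mu)); auto. }
  destruct (colouring_tree_exists lam c Hlam Hc) as (E & HE & HT).
  destruct (rank_exists E HE) as (t & Ht & Hrank).
  destruct (colouring_tree_high lam theta mu c E t) as (a & Ha & Hhigh); auto.
  destruct (high_node_homogeneous lam theta mu kappa a c E t)
    as (H & i & HHl & Heq & Hi); auto.
  exists H; split; [exact HHl|split; [exact Heq|]].
  assert (K : forall p u, pairs H p -> maps f p u -> u = i).
  { intros p u (x & y & Hx & Hy & Hxy & Hp) Hu.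
    apply upair_iff in Hp; subst p.
    (* The tree argument controls the colour with the smaller element first; an unordered pair is
       put in that order by trichotomy. *)
    assert (L : forall x y, x ∈ H -> y ∈ H -> x ∈ y ->
      maps f (upair x y) u -> u = i).
    { clear x y Hx Hy Hxy Hu; intros x y Hx Hy Hxy Hu.
      rewrite <- (Hi x y Hx Hy Hxy).
      now apply (maps_app f (pairs lam) (elements mu)) in Hu; auto. }
    destruct (ordinal_trichotomy x y) as [O|[O|O]];
      eauto using ordinal_mem; [tauto|].
    apply (L y x); auto; now rewrite upair_sym. }
  intros p q u v Hp Hq Hu Hv; rewrite (K p u), (K q v); auto.
Qed.

End SetTheory.

Theorem theorem3p2 (M : set_structure) (hZF : ZF M) (kappa mu : M)
    (hkappa : cardinal kappa) (hmu : ordinal mu) :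
  exists lam : M, cardinal lam /\ arrow2 lam kappa mu.
Proof. exact (erdos_rado M hZF kappa mu (proj1 hkappa)). Qed.
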